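(* Let $X=(X,d,\mu)$ be a $Q$-regular ($Q>1$), geodesic metric measure space and let $\Omega\subset X$ be a domain. Let $0<s<1$, $0<p<\infty$ and $0<q\le\infty$. Let $\mathcal{A}(\Omega)$ denote either $M^s_{p,q}(\Omega)$ or $N^s_{p,q}(\Omega)$. Then the following hold for each of these two choices of $\mathcal{A}(\Omega)$. (i) Suppose $sp<Q$ and put $p^*=\frac{Qp}{Q-sp}$. If there exists a constant $C$ such that $\|f\|_{L^{p^*}(\Omega)}\le C\|f\|_{\mathcal{A}(\Omega)}$ for all $f\in\mathcal{A}(\Omega)$, then $\Omega$ satisfies the measure density condition. (ii) Suppose $sp=Q$. If there exist constants $C_1,C_2>0$ such that for all $f\in\mathcal{A}(\Omega)$ with $\|f\|_{\mathcal{A}(\Omega)}\neq 0$ and for all balls $B\subset X$ with $\mu(B\cap\Omega)>0$, $$\int_{B\cap\Omega}\exp\left(C_1\frac{|f-f_{B\cap\Omega}|}{\|f\|_{\mathcal{A}(\Omega)}}\right)d\mu\le C_2\,\mu(B),$$ where $f_{B\cap\Omega}=\frac{1}{\mu(B\cap\Omega)}\int_{B\cap\Omega}f\,d\mu$, then $\Omega$ satisfies the measure density condition. (iii) Suppose $sp>Q$. If there exists a constant $C_3$ such that for all $f\in\mathcal{A}(\Omega)$ and for almost all $x,y\in\Omega$, $|f(x)-f(y)|\le C_3\|f\|_{\mathcal{A}(\Omega)}\,d(x,y)^{s-Q/p}$, then $\Omega$ satisfies the measure density condition. Here the measure density condition for $\Omega$ means: there exists a constant $c_m>0$ such that $\mu(B(x,r)\cap\Omega)\ge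 c_m\,\mu(B(x,r))$ for all $x\in\Omega$ and all $0<r\le1$.
   Context: A metric measure space $(X,d,\mu)$ is a metric space $(X,d)$ equipped with a Borel regular measure $\mu$ such that all balls have finite and positive measure. It is $Q$-regular, $Q>1$, if there is a constant $c_Q\ge1$ such that $c_Q^{-1}r^Q\le\mu(B(x,r))\le c_Q r^Q$ for each $x\in X$ and all $0<r\le\operatorname{diam}X$. It is geodesic if every pair of points can be joined by a curve whose length equals the distance between the points. A domain is a nonempty connected open set. Let $S\subset X$ be measurable and $0<s<\infty$. A sequence $(g_k)_{k\in\mathbb{Z}}$ of nonnegative measurable functions on $S$ is a fractional $s$-gradient of a measurable function $u:S\to[-\infty,\infty]$ in $S$ if there is a set $E\subset S$ with $\mu(E)=0$ such that $$|u(x)-u(y)|\le d(x,y)^s\big(g_k(x)+g_k(y)\big)$$ for all $k\in\mathbb{Z}$ and all $x,y\in S\setminus E$ satisfying $2^{k-1}\le d(x,y)<2^k$. The collection of all fractional $s$-gradients of $u$ is denoted $\mathbb{D}^s(u)$. For a sequence $\vec f=(f_k)_{k\in\mathbb{Z}}$ of measurable functions on $S$, put $$\|\vec f\|_{L^p(S,l^q)}=\big\|\,\|(f_k)_{k\in\mathbb{Z}}\|_{l^q}\,\big\|_{L^p(S)},\qquad \|\vec f\|_{l^q(L^p(S))}=\big\|(\|f_k\|_{L^p(S)})_{k\in\mathbb{Z}}\big\|_{l^q},$$ where $\|(f_k)\|_{l^q}=(\sum_{k\in\mathbb{Z}}|f_k|^q)^{1/q}$ for $0<q<\infty$ and $\|(f_k)\|_{l^\infty}=\sup_{k\in\mathbb{Z}}|f_k|$.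 The Hajłasz-Triebel-Lizorkin space $M^s_{p,q}(S)$ consists of the functions $u\in L^p(S)$ for which $$\|u\|_{M^s_{p,q}(S)}=\|u\|_{L^p(S)}+\inf_{\vec g\in\mathbb{D}^s(u)}\|\vec g\|_{L^p(S,l^q)}$$ is finite. The Hajłasz-Besov space $N^s_{p,q}(S)$ consists of the functions $u\in L^p(S)$ for which $$\|u\|_{N^s_{p,q}(S)}=\|u\|_{L^p(S)}+\inf_{\vec g\in\mathbb{D}^s(u)}\|\vec g\|_{l^q(L^p(S))}$$ is finite. Functions are identified when they agree almost everywhere. *)

(* Defs.v *)
From HB Require Import structures.
From mathcomp Require Import all_boot all_order all_algebra.
From mathcomp Require Import all_classical all_reals all_analysis.
From mathcomp Require Import measurable_realfun.
Import Order.TTheory GRing.Theory Num.Theory.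
Import numFieldNormedType.Exports.

Set Implicit Arguments.
Unset Strict Implicit.
Unset Printing Implicit Defensive.

Local Open Scope classical_set_scope.
Local Open Scope ring_scope.

#[short(type="metricMeasurableType")]
HB.structure Definition MetricMeasurable (d : measure_display)
    (K : numDomainType) := {T of Metric K T & Measurable d T}.

Section metric_measure_space.
Context (d : measure_display) (R : realType) (X : metricMeasurableType d R).
Implicit Types (mu : {measure set X -> \bar R}) (x y : X) (r : R).

(* The sigma-algebra of [X] may be strictly larger than the Borel one, e.g.
   the Caratheodory sigma-algebra of a Borel regular outer measure. *)
Definition borel_regular mu :=
  (forall U : set X, open U -> measurable U) /\
  (forall A : set X, measurable A ->
     exists B : set X, [/\ <<s @open X >> B, A `<=` B & mu A = mu B]).

Definition metric_measure_space mu :=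
  borel_regular mu /\
  (forall x r, 0 < r -> (0 < mu (ball x r) < +oo)%E).

Definition diam : \bar R :=
  ereal_sup [set e | exists x y, e = (mdist x y)%:E].

Definition regular_measure (Q : R) mu :=
  exists2 c : R, 1 <= c & forall x r, 0 < r -> (r%:E <= diam)%E ->
    ((c^-1 * r `^ Q)%:E <= mu (ball x r) <= (c * r `^ Q)%:E)%E.

Definition curve_length (a b : R) (gamma : R -> X) : \bar R :=
  ereal_sup [set (\sum_(0 <= i < size t)
      mdist (gamma (nth b (a :: t) i)) (gamma (nth b (a :: t) i.+1)))%:E
    | t in itv_partition a b].

Definition geodesic :=
  forall x y, exists (a b : R) (gamma : R -> X),
    [/\ a <= b, {within `[a, b], continuous gamma},
        gamma a = x, gamma b = y & curve_length a b gamma = (mdist x y)%:E].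

Definition domain (Omega : set X) :=
  [/\ Omega !=set0, connected Omega & open Omega].

Definition measure_density mu (Omega : set X) :=
  exists2 c : R, 0 < c & forall x r, Omega x -> 0 < r <= 1 ->
    (c%:E * mu (ball x r) <= mu (ball x r `&` Omega))%E.

End metric_measure_space.
Arguments geodesic {d R} X.
Arguments diam {d R} X.

Section hajlasz_spaces.
Context (d : measure_display) (R : realType) (X : metricMeasurableType d R).
Variable mu : {measure set X -> \bar R}.
Local Open Scope ereal_scope.

(* A function on [S] is represented by a function on [X] whose values outside
   [S] are ignored; [f \_ S] is [0] there. *)
Definition LpnormS (S : set X) (p : R) (f : X -> \bar R) : \bar R :=
  'N[mu]_p%:E[f \_ S].

Definition lqnorm (q : \bar R) (a : int -> \bar R) : \bar R :=
  match q with
  | q%:E => (\esum_(k in [set: int]) `|a k| `^ q) `^ q^-1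
  | +oo => ereal_sup (range (fun k => `|a k|))
  | -oo => 0
  end.

(* When [u x] or [u y] is infinite, [`|u x - u y|] is [+oo], also in the
   indeterminate cases. *)
Definition fractional_gradient (s : R) (S : set X) (u : X -> \bar R)
    (g : int -> X -> \bar R) :=
  [/\ forall k, measurable_fun S (g k),
      forall k x, S x -> 0 <= g k x &
      exists E : set X, [/\ E `<=` S, measurable E, mu E = 0 &
        forall (k : int) (x y : X), (S `\` E) x -> (S `\` E) y ->
          ((2 : R) ^ (k - 1) <= mdist x y < (2 : R) ^ k)%R ->
          `|u x - u y| <= ((mdist x y) `^ s)%:E * (g k x + g k y)]].

Variant hajlasz_scale := TriebelLizorkin | Besov.

Definition mixed_norm (A : hajlasz_scale) (p : R) (q : \bar R) (S : set X)
    (g : int -> X -> \bar R) : \bar R :=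
  match A with
  | TriebelLizorkin => LpnormS S p (fun x => lqnorm q (fun k => g k x))
  | Besov => lqnorm q (fun k => LpnormS S p (g k))
  end.

Definition hajlasz_norm (A : hajlasz_scale) (s p : R) (q : \bar R)
    (S : set X) (u : X -> \bar R) : \bar R :=
  LpnormS S p u +
  ereal_inf [set mixed_norm A p q S g | g in fractional_gradient s S u].

Definition hajlasz_space (A : hajlasz_scale) (s p : R) (q : \bar R)
    (S : set X) : set (X -> \bar R) :=
  [set u | [/\ measurable_fun S u, LpnormS S p u < +oo &
               hajlasz_norm A s p q S u < +oo]].

Definition mean (A : set X) (f : X -> \bar R) : \bar R :=
  ((fine (mu A))^-1)%:E * \int[mu]_(x in A) f x.

End hajlasz_spaces.

(* Main.v *)
Require Import Defs.
From mathcomp Require Import all_boot all_order all_algebra.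
From mathcomp Require Import all_classical all_reals all_analysis.
From mathcomp Require Import measurable_realfun.
From mathcomp Require Import ring lra.
Import Order.TTheory GRing.Theory Num.Theory.
Import numFieldNormedType.Exports.
Local Open Scope classical_set_scope.
Local Open Scope ring_scope.

(** Everything is read off one family of test functions.  The cutoff at [x] of
    radius [r] is 1 on [ball x (r / 2)], 0 off [ball x r] and Lipschitz with
    constant [2 / r].  The multiples [c k] of the indicator of [ball x r] form
    a fractional gradient of it, where [c k] is [r `^ (- s)] times a factor
    which decays geometrically as [2 ^ k] moves away from [r] in either
    direction; this is where [0 < s < 1] enters.  Since a geometric sequence
    has a finite norm in every sequence space, and all the members of the
    gradient are multiples of one function, the order of the two norms does
    not matter.  Hence, in both scales of spaces ([hajlasz_norm_cutoff_le]),
    the norm of the cutoff is at most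
      K * r `^ (- s) * vol x r `^ p^-1,
    where [vol x r] is the measure of [ball x r `&` Omega].  What has to be
    shown is [vol x r >= delta * r `^ Q] for small [r].

    Subcritical case.  Testing the Sobolev inequality with the cutoff bounds
    [vol x (r / 2)] by [vol x r] times a constant and a positive power of
    [vol x r / r `^ Q].  If this fraction is below a small threshold, it is
    not larger at radius [r / 2], hence below the threshold at all radii
    [r / 2 ^ n].  But [Omega] is open and contains whole small balls around
    [x], whose volumes are at least a fixed multiple of the power [Q] of the
    radius ([no_small_volume_descent]).

    Critical case.  A cutoff differs by at least 1 / 2 from its mean, as from any
    constant, on the half ball, where it is 1, or on the annulus between the
    radii [r] and [2 * r], where it is 0.  The exponential integrability makes
    the corresponding set tiny when [vol x r / r `^ Q] is small: either
    [vol x (r / 2)] is much smaller than [vol x r], or [vol x (2 * r)] barely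
    exceeds it ([moser_trudinger_dichotomy]).  The first alternative would
    propagate to all smaller radii, which the descent argument excludes.  So
    volumes hardly grow.  However, [Omega] is connected and contains a point [y]
    at distance [2 * r] from [x].  The balls of radius [r] around [x] and [y] are
    disjoint and both lie in [ball x (4 * r)], so the one around [y] carries
    little volume; but the volume of [ball y (4 * r)] hardly exceeds it, while
    that ball contains [ball x r].

    Supercritical case.  With the same kind of point [y], the cutoff drops from
    1 near [x] to 0 near [y] over a distance comparable to [r], and the Hoelder
    estimate directly bounds [vol x r] from below. *)

(** * Mixed sequence norms of geometric sequences *)

Section lqnorm_lemmas.
Context {R : realType}.
Implicit Types (q : \bar R) (a : int -> \bar R).
Local Open Scope ereal_scope.

Lemma lqnorm_ge0 q a : 0 <= lqnorm q a.
Proof.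
case: q => [q| |]//=; first exact: poweR_ge0.
apply: (@le_trans _ _ `|a 0%R|) => //.
by apply: ereal_sup_ubound; exists 0%R.
Qed.

Lemma le_lqnorm q a b : 0 < q -> (forall k, `|a k| <= `|b k|) ->
  lqnorm q a <= lqnorm q b.
Proof.
case: q => [q| |]//= q0 ab.
  have {}q0 : (0 < q)%R by rewrite lte_fin in q0.
  have q0' := ltW q0.
  have s0 c : \esum_(k in [set: int]) `|c k| `^ q \in `[0, +oo].
    by rewrite in_itv/= leey andbT esum_ge0// => k _; exact: poweR_ge0.
  apply: gt0_ler_poweR => //; first by rewrite invr_ge0.
  by apply: le_esum => k _; apply: gt0_ler_poweR; rewrite ?in_itv/= ?leey ?abse_ge0.
apply: ge_ereal_sup => _ [k _ <-]; apply: le_trans (ab k) _.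
by apply: ereal_sup_ubound; exists k.
Qed.

(** Homogeneity, of which one inequality is enough. *)
Lemma le_lqnormZ q (c : R) a : 0 < q -> (0 <= c)%R ->
  lqnorm q (fun k => c%:E * a k) <= c%:E * lqnorm q a.
Proof.
case: q => [q| |]//= q0 c0; last first.
  apply: ge_ereal_sup => _ [k _ <-]; rewrite abseM gee0_abs ?lee_fin//.
  by apply: lee_wpmul2l; rewrite ?lee_fin//; apply: ereal_sup_ubound; exists k.
have {}q0 : (0 < q)%R by rewrite lte_fin in q0.
have s0 b : 0 <= \esum_(k in [set: int]) `|b k| `^ q.
  by rewrite esum_ge0// => k _; exact: poweR_ge0.
have cE : c%:E = (c `^ q)%:E `^ q^-1.
  by rewrite poweR_EFin -powRrM mulfV ?gt_eqF// powRr1.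
rewrite [X in _ <= X * _]cE.
rewrite -poweRM//; last by rewrite lee_fin powR_ge0.
have sc0 : 0 <= (c `^ q)%:E * \esum_(k in [set: int]) `|a k| `^ q.
  by rewrite mule_ge0// lee_fin powR_ge0.
apply: gt0_ler_poweR; rewrite ?in_itv/= ?leey ?s0 ?sc0 ?invr_ge0 ?(ltW q0)//.
apply: ge_ereal_sup => _ [X [finX _]] <-.
have -> : \sum_(k \in X) `|c%:E * a k| `^ q =
    (c `^ q)%:E * \sum_(k \in X) `|a k| `^ q.
  rewrite ge0_mule_fsumr; last by move=> k; exact: poweR_ge0.
  apply: eq_fsbigr => k _.
  by rewrite abseM gee0_abs ?lee_fin// poweRM// ?lee_fin// poweR_EFin.
apply: lee_wpmul2l; first by rewrite lee_fin powR_ge0.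
by apply: ereal_sup_ubound; exists X.
Qed.

Lemma lqnorm_shift q a (n : int) :
  lqnorm q (fun k => a (k + n)%R) = lqnorm q a.
Proof.
case: q => [q| |]//=.
  congr (_ `^ _); apply/esym.
  apply: (reindex_esum _ _ (fun k => k + n)%R (fun k => `|a k| `^ q)).
  split => //.
    by move=> i j _ _; exact: addIr.
  by move=> i _; exists (i - n)%R => //; rewrite subrK.
congr ereal_sup; apply/seteqP; split => _ [k _ <-]; first by exists (k + n)%R.
by exists (k - n)%R => //; rewrite subrK.
Qed.

Lemma esum_geometric_lty (z : R) : (0 < z < 1)%R ->
  \esum_(n in [set: nat]) (z ^+ n)%:E < +oo.
Proof.
move=> /andP[z0 z1].
have zn0 n : 0 <= (z ^+ n)%:E by rewrite lee_fin exprn_ge0// ltW.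
rewrite -nneseries_esumT//; apply: (@le_lt_trans _ _ (1 / (1 - z))%:E); last exact: ltry.
apply: lime_le; first exact: is_cvg_nneseries.
near=> n; rewrite sumEFin lee_fin.
have := @geometric_le_lim R n 1 z ler01 z0.
rewrite ger0_norm ?(ltW z0)// => /(_ z1); congr (_ <= _)%R.
by rewrite /series/=; apply: eq_bigr => i _; rewrite mul1r.
Unshelve. all: by end_near. Qed.

Lemma lqnorm_geometric q (z : R) : 0 < q -> (0 < z < 1)%R ->
  lqnorm q (fun k => (z ^+ `|k|%N)%:E) < +oo.
Proof.
move=> + /[dup] z01 /andP[z0 z1]; case: q => [q| |]//= q0; last first.
  apply: (@le_lt_trans _ _ 1); last exact: ltry.
  apply: ge_ereal_sup => _ [k _ <-].
  by rewrite /= ger0_norm ?lee_fin ?exprn_ge0 ?exprn_ile1 ?(ltW z0) ?(ltW z1).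
have {}q0 : (0 < q)%R by rewrite lte_fin in q0.
apply: poweR_lty.
have w01 : (0 < z `^ q < 1)%R.
  rewrite powR_gt0//=.
  by have := @gt0_ltr_powR R q q0 z 1%R; rewrite !nnegrE powR1 ltW// ler01; exact.
have E (k : int) : `|(z ^+ `|k|%N)%:E| `^ q = ((z `^ q) ^+ `|k|%N)%:E.
  rewrite gee0_abs ?lee_fin ?exprn_ge0 ?ltW// poweR_EFin.
  by rewrite -(powR_mulrn _ (ltW z0)) -(powR_mulrn _ (powR_ge0 z q)) -!powRrM mulrC.
rewrite (@eq_esum _ _ _ _ (fun k : int => ((z `^ q) ^+ `|k|%N)%:E)); last first.
  by move=> k _; exact: E.
rewrite (esumID (range Posz)); last first.
  by move=> k _; rewrite lee_fin exprn_ge0// powR_ge0.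
rewrite !setTI; have -> : ~` range Posz = range Negz.
  apply/seteqP; split => -[k|k] //=.
  - by move=> h; exfalso; apply: h; exists k.
  - by move=> _; exists k.
  - by case.
  - by move=> _ [].
rewrite !esum_image; [|by move=> i j _ _ [] ..].
apply: lte_add_pinfty; first exact: esum_geometric_lty.
apply: (@le_lt_trans _ _ (\esum_(n in [set: nat]) ((z `^ q) ^+ n)%:E)); last first.
  exact: esum_geometric_lty.
apply: le_esum => k _.
rewrite NegzE abszN absz_nat lee_fin.
by case/andP: w01 => w0 w1; rewrite exprS ger_pMl ?exprn_gt0// ltW.
Qed.

End lqnorm_lemmas.

(** * Bounds for integrals and Lebesgue norms *)

Section integral_bounds.
Context {d : measure_display} {T : measurableType d} {R : realType}.
Variable mu : {measure set T -> \bar R}.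
Local Open Scope ereal_scope.

(** Monotonicity needs no measurability, because the integral of a nonnegative
    function is the supremum of the integrals of the simple functions below. *)
Lemma le_integral_nonneg (D : set T) (f g : T -> \bar R) :
  (forall x, D x -> 0 <= f x) -> (forall x, D x -> f x <= g x) ->
  \int[mu]_(x in D) f x <= \int[mu]_(x in D) g x.
Proof.
move=> f0 fg.
have g0 x : D x -> 0 <= g x by move=> Dx; exact: le_trans (f0 x Dx) (fg x Dx).
rewrite !ge0_integralE//; apply: le_ereal_sup => _ [h hf <-]; exists h => // x.
apply: (le_trans (hf x)); rewrite /patch; case: ifPn => // xD.
by apply: fg; rewrite inE in xD.
Qed.

Lemma integral_ge_cst (c : R) (S D : set T) (f : T -> \bar R) :
  (0 <= c)%R -> measurable S -> measurable D -> S `<=` D ->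
  (forall x, D x -> 0 <= f x) -> (forall x, S x -> c%:E <= f x) ->
  c%:E * mu S <= \int[mu]_(x in D) f x.
Proof.
move=> c0 mS mD SD f0 cf.
rewrite -integral_cst// integral_mkcond [leRHS]integral_mkcond.
apply: le_integral_nonneg => x _; rewrite /patch; case: ifPn => // xS.
  by rewrite inE in xS; rewrite mem_set; [exact: cf|exact: SD].
by case: ifPn => // xD; apply: f0; rewrite inE in xD.
Qed.

Lemma positive_measure_minus_null (B E : set T) : measurable B -> measurable E ->
  mu E = 0 -> 0 < mu B -> exists2 x, B x & ~ E x.
Proof.
move=> mB mE E0 B0; apply: contrapT => none.
suff : mu B <= mu E by rewrite E0 leNgt B0.
apply: le_measure; rewrite ?inE// => x Bx.
by apply: contrapT => Ex; apply: none; exists x.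
Qed.

End integral_bounds.

Section Lp.
Context {d : measure_display} {R : realType} {X : metricMeasurableType d R}.
Variable mu : {measure set X -> \bar R}.
Local Open Scope ereal_scope.

Lemma LpnormS_le_indic (S B : set X) (p c : R) (f : X -> \bar R) :
  measurable S -> measurable B -> (0 < p)%R -> (0 <= c)%R ->
  (forall x, S x -> `|f x| <= c%:E * (\1_B x)%:E) ->
  LpnormS mu S p f <= c%:E * mu (B `&` S) `^ p^-1.
Proof.
move=> mS mB p0 c0 fB; rewrite /LpnormS unlock.
have -> : c%:E = (c `^ p)%:E `^ p^-1.
  by rewrite poweR_EFin -powRrM mulfV ?gt_eqF// powRr1.
rewrite -poweRM ?lee_fin ?powR_ge0//.
have mBS : measurable (B `&` S) by exact: measurableI.
apply: gt0_ler_poweR; rewrite ?in_itv/= ?leey ?invr_ge0 ?(ltW p0)//.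
- by rewrite integral_ge0// => x _; exact: poweR_ge0.
- by rewrite mule_ge0// lee_fin powR_ge0.
rewrite -integral_cst// [leRHS]integral_mkcond.
apply: le_integral_nonneg => x _; first exact: poweR_ge0.
rewrite /patch; case: ifPn => xS; last first.
  rewrite abse0 poweR0r ?gt_eqF//; case: ifPn => // _.
  by rewrite lee_fin powR_ge0.
rewrite inE in xS; move: (fB x xS); rewrite indicE.
have [xB|xB] := boolP (x \in B).
  rewrite mule1 mem_set; last by split => //; rewrite inE in xB.
  move=> fc; rewrite -poweR_EFin; apply: gt0_ler_poweR => //.
  - exact: ltW.
  - by rewrite in_itv/= leey abse_ge0.
  - by rewrite in_itv/= leey lee_fin c0.
rewrite mule0 => fc.
have -> : `|f x| = 0 by apply/eqP; rewrite eq_le fc abse_ge0.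
by rewrite poweR0r ?gt_eqF//; case: ifPn => // _; rewrite lee_fin powR_ge0.
Qed.

Lemma LpnormS_ge (S B : set X) (p : R) (f : X -> \bar R) :
  measurable S -> measurable B -> (0 < p)%R ->
  (forall x, (B `&` S) x -> 1 <= `|f x|) ->
  mu (B `&` S) `^ p^-1 <= LpnormS mu S p f.
Proof.
move=> mS mB p0 fB; rewrite /LpnormS unlock.
have mBS : measurable (B `&` S) by exact: measurableI.
apply: gt0_ler_poweR; rewrite ?in_itv/= ?leey ?invr_ge0 ?(ltW p0) ?andbT//.
  by rewrite integral_ge0// => x _; exact: poweR_ge0.
rewrite -[leLHS]mul1e; apply: integral_ge_cst => //.
  by move=> x _; exact: poweR_ge0.
move=> x BSx; rewrite /patch mem_set; last by case: BSx.
rewrite -[leLHS](poweR1r p); apply: gt0_ler_poweR => //.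
- exact: ltW.
- by rewrite in_itv/= leey lee_fin ler01.
- by rewrite in_itv/= leey abse_ge0.
- exact: fB.
Qed.

Lemma LpnormS_ge0 (S : set X) (p : R) (f : X -> \bar R) : 0 <= LpnormS mu S p f.
Proof. exact: Lnorm_ge0. Qed.

(** The order in which the two norms are taken is irrelevant for a sequence of
    multiples of one function. *)
Lemma mixed_norm_indic_le A (p : R) (q : \bar R) (S B : set X) (c : int -> R) :
  measurable S -> measurable B -> mu (B `&` S) < +oo -> (0 < p)%R -> 0 < q ->
  (forall k, (0 <= c k)%R) -> lqnorm q (EFin \o c) < +oo ->
  mixed_norm mu A p q S (fun k x => (c k)%:E * (\1_B x)%:E) <=
  lqnorm q (EFin \o c) * mu (B `&` S) `^ p^-1.
Proof.
move=> mS mB BSoo p0 q0 c0 coo; case: A => /=.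
  have cfin : lqnorm q (EFin \o c) \is a fin_num.
    by rewrite ge0_fin_numE// lqnorm_ge0.
  rewrite -(fineK cfin); apply: LpnormS_le_indic => //.
    by rewrite fine_ge0// lqnorm_ge0.
  move=> x _; rewrite (fineK cfin) gee0_abs ?lqnorm_ge0// [leRHS]muleC.
  under eq_fun do rewrite muleC.
  by apply: (@le_lqnormZ _ q _ (EFin \o c)).
have Mfin : mu (B `&` S) `^ p^-1 \is a fin_num.
  by rewrite ge0_fin_numE ?poweR_ge0// poweR_lty.
rewrite -(fineK Mfin) muleC.
have M0 : (0 <= fine (mu (B `&` S) `^ p^-1))%R by rewrite fine_ge0// poweR_ge0.
apply: le_trans (le_lqnormZ q _ (EFin \o c) q0 M0).
apply: le_lqnorm => // k; rewrite gee0_abs ?LpnormS_ge0//.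
rewrite gee0_abs; last by rewrite mule_ge0// lee_fin.
rewrite (fineK Mfin) muleC; apply: LpnormS_le_indic => // x _.
by rewrite gee0_abs// mule_ge0// lee_fin.
Qed.

End Lp.

(** * Cutoff functions and their fractional gradients *)

Section powers.
Context {R : realType}.
Implicit Types (r s t : R).

(** The ratio of the geometric sequences that control both the powers
    [t `^ (- s)] at large scales and [t `^ (1 - s)] at small scales. *)
Definition decay s : R := 2 `^ (- Num.min s (1 - s)).

Lemma decay_itv s : 0 < s < 1 -> 0 < decay s < 1.
Proof.
move=> /andP[s0 s1]; rewrite /decay powR_gt0//=.
have m0 : 0 < Num.min s (1 - s) by rewrite lt_min s0 subr_gt0.
rewrite powRN invf_lt1 ?powR_gt0// -{1}[1](powRr0 2).
by rewrite /powR pnatr_eq0/= ltr_expR mul0r mulr_gt0// ln_gt0// ltr1n.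
Qed.

Lemma le_exp2_bound r : 0 <= r -> r <= 2 ^+ Num.bound r.
Proof.
move=> r0; apply: (le_trans (ltW (archi_boundP r0))).
by rewrite -natrX ler_nat; apply: ltnW; exact: ltn_expl.
Qed.

Lemma dyadic_scale r : 0 < r <= 1 ->
  exists n : nat, 2 `^ (- n%:R) <= r < 2 `^ (1 - n%:R).
Proof.
move=> /andP[r0 r1].
have ex : exists n : nat, 2 `^ (- n%:R) <= r.
  exists (Num.bound r^-1); rewrite powRN powR_mulrn// invf_ple ?posrE ?exprn_gt0//.
  by apply: le_exp2_bound; rewrite invr_ge0 ltW.
case: (ex_minnP ex) => n nr nmin; exists n; rewrite nr/=.
case: n nr nmin => [|n] nr nmin.
  by rewrite subr0 powRr1//; apply: le_lt_trans r1 _; rewrite ltr1n.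
have -> : 1 - n.+1%:R = - n%:R :> R by rewrite -natr1; ring.
by rewrite ltNge; apply/negP => /nmin; rewrite ltnn.
Qed.

(** The left side behaves like [1] for large [t] and like [t] for small [t];
    comparing it with [t `^ s] leaves the powers [t `^ (- s)] and
    [t `^ (1 - s)], and both decay geometrically away from [t = 1]. *)
Lemma min_le_decay s t (j : int) : 0 < s < 1 ->
  2 `^ (j%:~R - 2) <= t -> t <= 2 `^ j%:~R ->
  Num.min 1 (2 * t) <= 4 * (t `^ s * decay s ^+ `|j|%N).
Proof.
move=> /andP[s0 s1] t1 t2.
have two0 : (0 : R) < 2 by [].
have le2 a b : a <= b -> (2 : R) `^ a <= 2 `^ b by apply: ler_powR; rewrite ler1n.
have t0 : 0 < t by apply: lt_le_trans t1; exact: powR_gt0.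
have -> : (4 : R) = 2 `^ 2 by rewrite (powR_mulrn 2)//; ring.
set m := Num.min s (1 - s).
have ms : m <= s by rewrite /m ge_min lexx.
have ms' : m <= 1 - s by rewrite /m ge_min lexx orbT.
rewrite -powR_mulrn ?powR_ge0// /decay -/m -powRrM.
have [j0|j0] := leP 0 j.
  rewrite ge_min; apply/orP; left.
  have -> : (`|j|%N%:R : R) = j%:~R by rewrite natr_absz ger0_norm.
  have J0 : 0 <= j%:~R :> R by rewrite ler0z.
  apply: (@le_trans _ _ (2 `^ 2 * (2 `^ ((j%:~R - 2) * s) * 2 `^ (- m * j%:~R)))).
    rewrite -!powRD ?pnatr_eq0 ?implybT//.
    rewrite -{1}[1](powRr0 2); apply: le2; nra.
  apply: ler_wpM2l; first exact: powR_ge0.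
  apply: ler_wpM2r; first exact: powR_ge0.
  rewrite powRrM; apply: ge0_ler_powR => //; rewrite ?nnegrE ?powR_ge0 ?ltW//.
rewrite ge_min; apply/orP; right.
have -> : (`|j|%N%:R : R) = - j%:~R by rewrite natr_absz ltr0_norm// mulrNz.
have J0 : j%:~R <= 0 :> R by rewrite lerz0 ltW.
have tE : t = t `^ s * t `^ (1 - s).
  by rewrite -powRD ?(gt_eqF t0) ?implybT// addrC subrK powRr1// ltW.
rewrite [in leLHS]tE mulrNN mulrCA [in leRHS]mulrCA.
apply: ler_wpM2l; first exact: powR_ge0.
have t3 : t `^ (1 - s) <= 2 `^ (m * j%:~R).
  apply: (@le_trans _ _ (2 `^ (j%:~R * (1 - s)))); last by apply: le2; nra.
  by rewrite powRrM; apply: ge0_ler_powR; rewrite ?nnegrE ?powR_ge0 ?(ltW t0)//; lra.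
apply: ler_pM => //; first exact: powR_ge0.
by rewrite -{1}[2]powRr1//; apply: le2; rewrite ler1n.
Qed.

(** The bound [1 + t <= expR t] at [t = y / m], raised to the power [m]. *)
Lemma powR_le_expR (y m : R) : 0 < m -> 0 <= y -> (y / m) `^ m <= expR y.
Proof.
move=> m0 y0; have -> : expR y = expR (y / m) `^ m.
  by rewrite /powR gt_eqF ?expR_gt0// expRK mulrC divfK// gt_eqF.
have ym0 : 0 <= y / m by rewrite divr_ge0// ltW.
apply: ge0_ler_powR; rewrite ?nnegrE ?(ltW m0) ?ym0 ?expR_ge0//.
by apply: le_trans (expR_ge1Dx _); rewrite lerDr.
Qed.

End powers.

Section cutoff.
Context {d : measure_display} {R : realType} {X : metricMeasurableType d R}.
Implicit Types (x y z : X) (r s : R).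

Definition cutoff x r z : R := Num.min 1 (Num.max 0 (2 - 2 * (mdist x z / r))).

Lemma cutoff_ge0 x r z : 0 <= cutoff x r z.
Proof. by rewrite /cutoff le_min ler01 le_max lexx. Qed.

Lemma cutoff_le1 x r z : cutoff x r z <= 1.
Proof. by rewrite /cutoff ge_min lexx. Qed.

Lemma cutoff_eq1 x r z : 0 < r -> ball x (r / 2) z -> cutoff x r z = 1.
Proof.
move=> r0; rewrite ballEmdist/= => xz; rewrite /cutoff; apply/min_idPl.
rewrite le_max; apply/orP; right.
have : mdist x z / r < 1 / 2 by rewrite ltr_pdivrMr// mul1r mulrC.
lra.
Qed.

Lemma cutoff_eq0 x r z : 0 < r -> ~ ball x r z -> cutoff x r z = 0.
Proof.
move=> r0; rewrite ballEmdist/= => /negP; rewrite -leNgt => xz.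
have xzr : 1 <= mdist x z / r by rewrite ler_pdivlMr// mul1r.
rewrite /cutoff max_l; last lra.
by apply/min_idPr.
Qed.

Lemma cutoff_lipschitz x r y z : 0 < r ->
  `|cutoff x r y - cutoff x r z| <= 2 * (mdist y z / r).
Proof.
move=> r0.
have yz : `|mdist x y / r - mdist x z / r| <= mdist y z / r.
  rewrite -mulrBl normrM (gtr0_norm (_ : 0 < r^-1)) ?invr_gt0//.
  apply: ler_wpM2r; first by rewrite invr_ge0 ltW.
  rewrite ler_norml; have := metric_triangle x y z.
  have := metric_triangle x z y; rewrite (metric_sym z y); lra.
move: yz; rewrite /cutoff.
set a := mdist x y / r; set b := mdist x z / r; set c := mdist y z / r.
rewrite !ler_norml /Num.min /Num.max; do ?case: ifPn; rewrite -?leNgt; lra.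
Qed.

Context (open_measurable : forall U : set X, open U -> measurable U).

Lemma measurable_ball x r : measurable (ball x r : set X).
Proof.
apply: open_measurable; rewrite openE => y; rewrite ballEmdist/= => xy.
have r0 : 0 < r - mdist x y by rewrite subr_gt0.
apply: (filterS _ (nbhsx_ballx y _ r0)) => z; rewrite !ballEmdist/= => yz.
by apply: le_lt_trans (metric_triangle x y z) _; lra.
Qed.

Lemma measurable_cutoff x r (D : set X) : measurable D ->
  measurable_fun D (cutoff x r).
Proof.
move=> mD.
have md : measurable_fun D (fun z : X => mdist x z).
  apply: (measurability (@RGenCInfty.G R)) => [|/= _ [_] [e] -> <-].
    exact: RGenCInfty.measurableE.
  rewrite (_ : _ @^-1` _ = ~` ball x e); last first.
    apply/seteqP; split => z; rewrite /= in_itv/= andbT ballEmdist/= leNgt.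
      by move/negP.
    by move=> ?; apply/negP.
  by apply: measurableI => //; apply: measurableC; exact: measurable_ball.
apply: measurable_minr => //; apply: measurable_maxr => //.
apply: measurable_funB => //; apply: measurable_funM => //.
exact: measurable_funM.
Qed.

(** If [y] or [z] lies in [ball x r], the right side of the gradient inequality
    contains the coefficient at least once; otherwise the left side vanishes.
    The integer [n] is the dyadic logarithm of [1 / r], so that shifting the
    index by [n] rescales the radius to 1 up to a factor 2. *)
Lemma cutoff_gradient (mu : {measure set X -> \bar R}) (S : set X) x r s
    (n : nat) : measurable S -> 0 < s < 1 -> 0 < r ->
  2 `^ (- n%:R) <= r < 2 `^ (1 - n%:R) ->
  fractional_gradient mu s S (EFin \o cutoff x r)
    (fun k z => (4 * r `^ (- s) * decay s ^+ `|(k + n%:Z)%R|%N)%:E *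
                (\1_(ball x r) z)%:E)%E.
Proof.
move=> mS s01 r0 /andP[rn nr].
have [dec0 dec1] := andP (decay_itv s s01).
have c0 (k : int) : 0 <= 4 * r `^ (- s) * decay s ^+ `|(k + n%:Z)%R|%N.
  by rewrite !mulr_ge0// ?powR_ge0// exprn_ge0// ltW.
split.
- move=> k; apply: measurable_funeM; apply/measurable_EFinP.
  by apply: measurable_indic; exact: measurable_ball.
- by move=> k z _; rewrite mule_ge0// lee_fin.
exists set0; split => // k y z _ _ /andP[d1 d2].
set c := 4 * _ * _.
have [yzB|yzB] := pselect (ball x r y \/ ball x r z); last first.
  have [yB zB] : ~ ball x r y /\ ~ ball x r z by split => h; apply: yzB; [left|right].
  by rewrite /= !cutoff_eq0// subrr normr0 lee_fin mulr_ge0 ?powR_ge0// addr_ge0// mulr_ge0// /c c0.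
have c1 : (c%:E <= c%:E * (\1_(ball x r) y)%:E + c%:E * (\1_(ball x r) z)%:E)%E.
  rewrite -!EFinM -EFinD lee_fin -mulrDr ler_peMr ?c0//.
  rewrite !indicE; case: yzB => B.
    by rewrite (mem_set B) lerDl.
  by rewrite (mem_set B) lerDr.
apply: (@le_trans _ _ ((mdist y z `^ s)%:E * c%:E)%E); last first.
  by apply: lee_wpmul2l => //; rewrite lee_fin powR_ge0.
rewrite /= -EFinM lee_fin /c.
have rE : r `^ s * r `^ (- s) = 1 by rewrite powRN divff// gt_eqF// powR_gt0.
have dE : mdist y z `^ s = (mdist y z / r) `^ s * r `^ s.
  by rewrite -powRM ?divfK ?gt_eqF// ?divr_ge0 ?mdist_ge0// ltW.
have -> : mdist y z `^ s * (4 * r `^ (- s) * decay s ^+ `|(k + n%:Z)%R|%N) =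
    4 * ((mdist y z / r) `^ s * decay s ^+ `|(k + n%:Z)%R|%N).
  by rewrite dE; ring: rE.
have kE : (2 : R) ^ k = 2 `^ (k%:~R) by rewrite powR_intmul.
have k1E : (2 : R) ^ (k - 1) = 2 `^ (k%:~R - 1).
  by rewrite -powR_intmul// intrB.
apply: (@le_trans _ _ (Num.min 1 (2 * (mdist y z / r)))).
  rewrite le_min cutoff_lipschitz// andbT.
  have := cutoff_ge0 x r y; have := cutoff_ge0 x r z.
  have := cutoff_le1 x r y; have := cutoff_le1 x r z.
  rewrite ler_norml; lra.
apply: min_le_decay => //.
- rewrite ler_pdivlMr//; apply: le_trans d1; rewrite k1E.
  apply: (@le_trans _ _ (2 `^ ((k + n%:Z)%:~R - 2) * 2 `^ (1 - n%:R))).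
    by apply: ler_wpM2l; [exact: powR_ge0|exact: ltW].
  rewrite -powRD ?pnatr_eq0 ?implybT// intrD.
  by rewrite [X in 2 `^ X](_ : _ = k%:~R - 1)//; ring.
- rewrite ler_pdivrMr//; apply: (le_trans (ltW d2)); rewrite kE.
  apply: (@le_trans _ _ (2 `^ ((k + n%:Z)%:~R) * 2 `^ (- n%:R))).
    rewrite -powRD ?pnatr_eq0 ?implybT// intrD.
    by rewrite [X in _ <= 2 `^ X](_ : _ = k%:~R)//; ring.
  by apply: ler_wpM2l => //; exact: powR_ge0.
Qed.

End cutoff.

(** * Hajlasz norms of cutoff functions *)

Section cutoff_norm.
Context {d : measure_display} {R : realType} {X : metricMeasurableType d R}.
Context (mu : {measure set X -> \bar R}).
Context (open_measurable : forall U : set X, open U -> measurable U).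
Context (A : hajlasz_scale) (s p : R) (q : \bar R).
Context (s01 : 0 < s < 1) (p0 : 0 < p) (q0 : (0 < q)%E).

(** The gradient part of the norm is nonnegative; this keeps the norm of a
    cutoff away from 0. *)
Lemma hajlasz_norm_ge (S B : set X) (f : X -> \bar R) :
  measurable S -> measurable B ->
  (forall x, (B `&` S) x -> (1 <= `|f x|)%E) ->
  (mu (B `&` S) `^ p^-1 <= hajlasz_norm mu A s p q S f)%E.
Proof.
move=> mS mB fB; apply: (le_trans (LpnormS_ge mu S B p f mS mB p0 fB)).
rewrite leeDl//; apply: le_ereal_inf_tmp => _ [g _ <-].
by case: (A) => /=; [exact: LpnormS_ge0|exact: lqnorm_ge0].
Qed.

Lemma hajlasz_norm_cutoff_le : exists2 K : R, 0 < K &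
  forall (S : set X) (x : X) (r : R), measurable S -> 0 < r <= 1 ->
    (mu (ball x r `&` S) < +oo)%E ->
    hajlasz_space mu A s p q S (EFin \o cutoff x r) /\
    (hajlasz_norm mu A s p q S (EFin \o cutoff x r) <=
      (K * r `^ (- s))%:E * mu (ball x r `&` S) `^ p^-1)%E.
Proof.
have [dec0 dec1] := andP (decay_itv s s01).
pose L := lqnorm q (fun k => (decay s ^+ `|k|%N)%:E).
have L0 : (0 <= L)%E by exact: lqnorm_ge0.
have Loo : (L < +oo)%E by apply: lqnorm_geometric => //; exact: decay_itv.
have Lfin : L \is a fin_num by rewrite ge0_fin_numE.
(* The summand 1 accounts for the Lebesgue norm of the cutoff itself, since
   [1 <= r `^ (- s)]. *)
exists (1 + 4 * fine L); first by rewrite ltr_wpDr// mulr_ge0// fine_ge0.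
move=> S x r mS /andP[r0 r1] Boo.
have mB : measurable (ball x r : set X) by exact: measurable_ball.
have [n rn] : exists n : nat, 2 `^ (- n%:R) <= r < 2 `^ (1 - n%:R).
  by apply: dyadic_scale; rewrite r0.
set f := EFin \o cutoff x r.
pose c (k : int) := 4 * r `^ (- s) * decay s ^+ `|(k + n%:Z)%R|%N.
have c0 k : 0 <= c k by rewrite !mulr_ge0// ?powR_ge0// exprn_ge0// ltW.
have cL : (lqnorm q (EFin \o c) <= (4 * r `^ (- s))%:E * L)%E.
  rewrite /L -(lqnorm_shift q (fun k : int => (decay s ^+ `|k|%N)%:E) n%:Z).
  have -> : EFin \o c = fun k =>
      ((4 * r `^ (- s))%:E * (decay s ^+ `|(k + n%:Z)%R|%N)%:E)%E.
    by apply/funext => k; rewrite -EFinM.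
  by apply: le_lqnormZ; rewrite // mulr_ge0// powR_ge0.
have coo : (lqnorm q (EFin \o c) < +oo)%E.
  by apply: (le_lt_trans cL); rewrite -(fineK Lfin) -EFinM ltry.
set M := (mu (ball x r `&` S) `^ p^-1)%E.
have M0 : (0 <= M)%E by exact: poweR_ge0.
have Moo : (M < +oo)%E by exact: poweR_lty.
have fM : (LpnormS mu S p f <= M)%E.
  rewrite -[leRHS]mul1e; apply: LpnormS_le_indic => // z _.
  rewrite mul1e /= lee_fin ger0_norm ?cutoff_ge0// indicE.
  have [zB|zB] := boolP (z \in _); first exact: cutoff_le1.
  by rewrite cutoff_eq0// => /mem_set; exact/negP.
have fN : (hajlasz_norm mu A s p q S f <=
    ((1 + 4 * fine L) * r `^ (- s))%:E * M)%E.
  apply: (@le_trans _ _ (M + lqnorm q (EFin \o c) * M)%E).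
    apply: leeD => //.
    apply: le_trans (mixed_norm_indic_le mu A p q S _ c mS mB Boo p0 q0 c0 coo).
    apply: ereal_inf_lbound; exists (fun k z => (c k)%:E * (\1_(ball x r) z)%:E)%E => //.
    exact: cutoff_gradient.
  apply: (@le_trans _ _ (1%:E * M + (4 * r `^ (- s))%:E * L * M)%E).
    by rewrite mul1e leeD2l// lee_wpmul2r.
  have h4 : (0 <= (4 * r `^ (- s))%:E * L)%E.
    by rewrite mule_ge0// lee_fin mulr_ge0// powR_ge0.
  rewrite -ge0_muleDl// -(fineK Lfin).
  apply: lee_wpmul2r => //; rewrite -EFinM -EFinD lee_fin /=.
  have : 1 <= r `^ (- s).
    rewrite powRN invf_ge1 ?powR_gt0//.
    have /andP[s0 _] := s01.
    have := @ge0_ler_powR R s (ltW s0) r 1.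
    by rewrite !nnegrE powR1 (ltW r0) ler01; apply.
  lra.
split => //; split.
- apply/measurable_EFinP; exact: measurable_cutoff.
- exact: le_lt_trans Moo.
- apply: le_lt_trans fN _.
  by rewrite lte_mul_pinfty// lee_fin mulr_ge0 ?powR_ge0// addr_ge0// mulr_ge0// fine_ge0.
Qed.

End cutoff_norm.

(** * Volumes of balls in the domain *)

Section volume.
Context {d : measure_display} {R : realType} {X : metricMeasurableType d R}.
Context (mu : {measure set X -> \bar R}) (Q : R) (Omega : set X).
Context (mu_metric : metric_measure_space mu) (Q1 : 1 < Q).
Context (mu_regular : regular_measure Q mu) (Omega_domain : domain Omega).
Implicit Types (x y z : X) (r t delta : R).

Let open_measurable : forall U : set X, open U -> measurable U.
Proof. by case: mu_metric => -[]. Qed.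

Let open_Omega : open Omega. Proof. by case: Omega_domain. Qed.

Definition vol x r : R := fine (mu (ball x r `&` Omega)).

Lemma measurable_ball_domain x r : measurable (ball x r `&` Omega).
Proof.
by apply: measurableI; [exact: measurable_ball|exact: open_measurable].
Qed.

Lemma le_mu_ball x y r t : (ball x r `&` Omega) `<=` (ball y t `&` Omega) ->
  (mu (ball x r `&` Omega) <= mu (ball y t `&` Omega))%E.
Proof. by move=> h; apply: le_measure; rewrite ?inE//; exact: measurable_ball_domain. Qed.

Lemma volE x r : 0 < r -> mu (ball x r `&` Omega) = (vol x r)%:E.
Proof.
move=> r0; rewrite fineK// ge0_fin_numE//.
case: mu_metric => _ /(_ x r r0) /andP[_]; apply: le_lt_trans.
apply: le_measure; rewrite ?inE.
- exact: measurable_ball_domain.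
- exact: measurable_ball.
- exact: subIsetl.
Qed.

Lemma vol_gt0 x r : Omega x -> 0 < r -> 0 < vol x r.
Proof.
move=> Ox r0; rewrite -lte_fin -volE//.
have := open_nbhs_nbhs (conj open_Omega Ox).
rewrite -nbhs_ballE => -[e /= e0 eO].
have m0 : 0 < Num.min e r by rewrite lt_min e0.
case: mu_metric => _ /(_ x _ m0) /andP[+ _] => /lt_le_trans; apply.
apply: le_measure; rewrite ?inE.
- exact: measurable_ball.
- exact: measurable_ball_domain.
- rewrite subsetI; split; last apply: subset_trans eO;
    by apply: le_ball; rewrite ge_min lexx ?orbT.
Qed.

Lemma le_vol x y r t : 0 < r -> 0 < t -> ball x r `<=` ball y t ->
  vol x r <= vol y t.
Proof.
move=> r0 t0 xy; rewrite -lee_fin -!volE//; apply: le_mu_ball.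
exact: setSI.
Qed.

Lemma subset_ball x y r t : mdist y x + r <= t -> ball x r `<=` ball y t.
Proof.
move=> yx z; rewrite !ballEmdist/= => xz.
apply: le_lt_trans (metric_triangle y x z) _.
by apply: lt_le_trans yx; rewrite ltrD2l.
Qed.

(** Close to a point of the open set [Omega] the ball lies inside [Omega] and
    has the full volume, so no condition that forces a small volume fraction
    can propagate along all the radii [r / 2 ^ n]. *)
Lemma no_small_volume_descent : exists2 delta0 : R, 0 < delta0 &
  forall (delta r : R) x (I : R -> Prop), Omega x -> (0 < r) -> delta < delta0 ->
    (r%:E <= @diam _ _ X)%E ->
    (forall t, 0 < t <= r -> I t -> vol x t <= delta * t `^ Q /\ I (t / 2)) ->
    ~ I r.
Proof.
case: mu_regular => c c1 reg; exists c^-1; first by rewrite invr_gt0; lra.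
move=> delta r x I Ox r0 dc rdiam step Ir.
have := open_nbhs_nbhs (conj open_Omega Ox).
rewrite -nbhs_ballE => -[e /= e0 eO].
have rn0 n : 0 < r / 2 ^+ n by rewrite divr_gt0// exprn_gt0.
have rn n : r / 2 ^+ n <= r.
  by rewrite ler_pdivrMr ?exprn_gt0// ler_peMr ?(ltW r0)// exprn_ege1// ler1n.
have In n : I (r / 2 ^+ n).
  elim: n => [|n IHn]; first by rewrite expr0 divr1.
  have [|_] := step _ _ IHn; first by rewrite rn0 rn.
  by rewrite exprSr invfM mulrA.
have [n ne] : exists n : nat, r / 2 ^+ n <= e.
  exists (Num.bound (r / e)); rewrite ler_pdivrMr ?exprn_gt0// mulrC -ler_pdivrMr//.
  by apply: le_exp2_bound; rewrite divr_ge0// ltW.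
have [|vs _] := step _ _ (In n); first by rewrite rn0 rn.
have : (mu (ball x (r / 2 ^+ n)) <= (vol x (r / 2 ^+ n))%:E)%E.
  rewrite -volE//; apply: le_measure; rewrite ?inE.
  - exact: measurable_ball.
  - exact: measurable_ball_domain.
  - by rewrite subsetI; split => //; apply: subset_trans eO; exact: le_ball.
apply/negP; rewrite -ltNge.
have rnd : ((r / 2 ^+ n)%:E <= @diam _ _ X)%E.
  by apply: le_trans rdiam; rewrite lee_fin.
have /andP[+ _] := reg x _ (rn0 n) rnd.
apply: lt_le_trans; rewrite lte_fin.
by apply: le_lt_trans vs _; rewrite ltr_pM2r ?powR_gt0.
Qed.

(** A radius [r <= 1] is compared with the radius [r * r0 <= r0].  The measure of
    a ball of radius [r] is at most a multiple of [r `^ Q] even beyond the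
    diameter, because the whole space is then a ball of finite measure. *)
Lemma measure_density_of_small_scales (delta r0 : R) :
  0 < delta -> 0 < r0 <= 1 -> (r0%:E <= @diam _ _ X)%E ->
  (forall x r, Omega x -> 0 < r <= r0 -> delta * r `^ Q <= vol x r) ->
  measure_density mu Omega.
Proof.
move=> delta0 /andP[r00 r01] r0d small.
have Q0 : 0 <= Q := ltW (lt_trans ltr01 Q1).
case: mu_regular => c c1 reg.
have [[x0 Ox0] _ _] := Omega_domain.
pose V := fine (mu (ball x0 2)).
have /andP[V0 Voo] : (0 < mu (ball x0 2) < +oo)%E.
  by case: mu_metric => _; apply.
have VE : mu (ball x0 2) = V%:E by rewrite fineK// ge0_fin_numE.
have {}V0 : 0 < V by rewrite -lte_fin -VE.
have r0Q : 0 < r0 `^ Q by exact: powR_gt0.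
pose c' := c + V / r0 `^ Q.
have c'0 : 0 < c' by rewrite addr_gt0 ?divr_gt0//; lra.
have upper x r : 0 < r <= 1 -> (mu (ball x r) <= (c' * r `^ Q)%:E)%E.
  move=> /andP[rp r1]; have rQ : 0 < r `^ Q by exact: powR_gt0.
  have [rd|rd] := leP r%:E (@diam _ _ X).
    have /andP[_ /le_trans] := reg x r rp rd; apply.
    by rewrite lee_fin ler_pM2r// lerDl divr_ge0// ltW.
  apply: (@le_trans _ _ V%:E).
    rewrite -VE; apply: le_measure; rewrite ?inE; [exact: measurable_ball..|].
    move=> z _; rewrite ballEmdist/= -lte_fin; apply: le_lt_trans (_ : 1%:E < _)%E.
      apply: (@le_trans _ _ (@diam _ _ X)); last by apply: le_trans (ltW rd) _; rewrite lee_fin.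
      by apply: ereal_sup_ubound; exists x0, z.
    by rewrite lte_fin ltr1n.
  rewrite lee_fin mulrDl; apply: (@le_trans _ _ (V / r0 `^ Q * r `^ Q)).
    rewrite mulrAC -mulrA ler_pMr// ler_pdivlMr// mul1r.
    apply: ge0_ler_powR; rewrite ?nnegrE ?(ltW r00) ?(ltW rp)//.
    by rewrite ltW// -lte_fin; exact: (le_lt_trans r0d rd).
  by rewrite lerDr mulr_ge0 ?ltW//; lra.
exists (delta * r0 `^ Q / c'); first by rewrite divr_gt0// mulr_gt0.
move=> x r Ox /andP[rp r1].
have rr0 : 0 < r * r0 by exact: mulr_gt0.
apply: (@le_trans _ _ (delta * (r * r0) `^ Q)%:E).
  apply: (@le_trans _ _ ((delta * r0 `^ Q / c')%:E * (c' * r `^ Q)%:E)%E).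
    apply: lee_wpmul2l; last by apply: upper; rewrite rp.
    by rewrite lee_fin divr_ge0 ?mulr_ge0 ?ltW.
  rewrite -EFinM lee_fin powRM ?(ltW rp) ?(ltW r00)//.
  by rewrite [leLHS]mulrA divfK ?gt_eqF// -mulrA [r0 `^ Q * _]mulrC.
rewrite volE// lee_fin; apply: le_trans (small x _ Ox _) _.
  by rewrite rr0/= ler_piMl// ltW.
apply: le_vol => //; apply: le_ball; rewrite ler_piMr// ltW//.
Qed.

End volume.

(** * Distances attained in the domain *)

Section spheres.
Context {d : measure_display} {R : realType} {X : metricMeasurableType d R}.
Context (mu : {measure set X -> \bar R}) (Q : R) (Omega : set X).
Context (mu_metric : metric_measure_space mu) (Q1 : 1 < Q).
Context (mu_regular : regular_measure Q mu) (Omega_domain : domain Omega).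

Lemma continuous_mdist (x : X) : continuous (fun z : X => mdist x z : R^o).
Proof.
move=> y; apply/cvgrPdist_lt => e e0.
apply: (filterS _ (nbhsx_ballx y e e0)) => z; rewrite ballEmdist/=.
apply: le_lt_trans; rewrite ler_norml.
have := metric_triangle x y z; have := metric_triangle x z y.
rewrite (metric_sym z y); lra.
Qed.

(** A one-point domain would be an atom, and regularity excludes atoms. *)
Lemma domain_nontrivial : (exists a b : X, a <> b) ->
  exists a b : X, [/\ Omega a, Omega b & a <> b].
Proof.
move=> [a0 [b0 ab0]]; have [[a Oa] _ _] := Omega_domain.
apply: contrapT => none.
have Oeq b : Omega b -> a = b.
  by move=> Ob; apply: contrapT => ab; apply: none; exists a, b.
case: mu_regular => c c1 reg.
have c0 : 0 < c by lra.
have Q0 : 0 < Q := lt_trans ltr01 Q1.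
have D0 : 0 < mdist a0 b0 by rewrite mdist_gt0; apply/eqP.
have v0 : 0 < vol mu Omega a 1 by exact: (vol_gt0 mu).
set v := vol mu Omega a 1 in v0.
pose w := (v / 2 / c) `^ Q^-1.
have w0 : 0 < w by rewrite powR_gt0// !divr_gt0.
pose rho := Num.min (mdist a0 b0) w.
have rho0 : 0 < rho by rewrite lt_min D0.
have rhod : (rho%:E <= @diam _ _ X)%E.
  apply: (@le_trans _ _ (mdist a0 b0)%:E); first by rewrite lee_fin ge_min lexx.
  by apply: ereal_sup_ubound; exists a0, b0.
have /andP[_ up] := reg a rho rho0 rhod.
have : (v%:E <= (c * rho `^ Q)%:E)%E.
  apply: le_trans up; rewrite -(volE mu) //; apply: le_measure; rewrite ?inE.
  - exact: (measurable_ball_domain mu).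
  - by apply: measurable_ball; case: mu_metric => -[].
  - by move=> z [_ /Oeq <-]; exact: ballxx.
rewrite lee_fin; apply/negP; rewrite -ltNge.
apply: (@le_lt_trans _ _ (v / 2)); last lra.
rewrite mulrC -ler_pdivlMr//.
have -> : v / 2 / c = w `^ Q.
  by rewrite /w -powRrM mulVf ?gt_eqF// powRr1// !divr_ge0// ltW.
apply: ge0_ler_powR; rewrite ?nnegrE ?(ltW Q0) ?(ltW rho0) ?(ltW w0)//.
by rewrite ge_min lexx orbT.
Qed.

(** A point of [Omega] is far from one of two fixed points of [Omega], and the
    distance to it takes all intermediate values on the connected set. *)
Lemma domain_meets_spheres : (exists a b : X, a <> b) ->
  exists r0 : R, [/\ 0 < r0, r0 <= 1, (r0%:E <= @diam _ _ X)%E &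
    forall (x : X) (t : R), Omega x -> 0 < t <= r0 -> exists2 y, Omega y & mdist x y = t].
Proof.
move=> /domain_nontrivial [a [b [Oa Ob ab]]].
have [_ conn _] := Omega_domain.
have D0 : 0 < mdist a b by rewrite mdist_gt0; apply/eqP.
exists (Num.min 1 (mdist a b / 2)); split.
- by rewrite lt_min ltr01 divr_gt0.
- by rewrite ge_min lexx.
- apply: (@le_trans _ _ (mdist a b)%:E).
    by rewrite lee_fin ge_min; apply/orP; right; lra.
  by apply: ereal_sup_ubound; exists a, b.
move=> x t Ox; rewrite le_min => /and3P[t0 _ tab].
have [w Ow tw] : exists2 w, Omega w & t <= mdist x w.
  have := metric_triangle a x b; rewrite (metric_sym a x).
  have [?|?] := leP t (mdist x a); first by exists a.
  by exists b => //; lra.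
have : is_interval [set (mdist x z : R) | z in Omega].
  apply/connected_intervalP.
  apply: (@connected_continuous_connected X R^o) => //.
  by apply: continuous_subspaceT; exact: continuous_mdist.
have D1 : [set (mdist x z : R) | z in Omega] 0 by exists x; rewrite ?mdistxx.
have D2 : [set (mdist x z : R) | z in Omega] (mdist x w) by exists w.
have t0w : 0 <= t <= mdist x w by rewrite (ltW t0).
by move=> /(_ _ _ D1 D2 t t0w) [y Oy yt]; exists y.
Qed.

End spheres.

(** * Embeddings imply measure density *)

Section necessity.
Context {d : measure_display} {R : realType} {X : metricMeasurableType d R}.
Context (mu : {measure set X -> \bar R}) (Q : R) (Omega : set X).
Context (mu_metric : metric_measure_space mu) (Q1 : 1 < Q).
Context (mu_regular : regular_measure Q mu) (Omega_domain : domain Omega).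
Context (A : hajlasz_scale) (s p : R) (q : \bar R).
Context (s01 : 0 < s < 1) (p0 : 0 < p) (q0 : (0 < q)%E).
Context (r0 : R) (r00 : 0 < r0) (r01 : r0 <= 1) (r0d : (r0%:E <= @diam _ _ X)%E).
Context (spheres : forall (x : X) (t : R), Omega x -> 0 < t <= r0 ->
  exists2 y, Omega y & mdist x y = t).

Let open_measurable : forall U : set X, open U -> measurable U.
Proof. by case: mu_metric => -[]. Qed.

Let measurable_Omega : measurable Omega.
Proof. by apply: open_measurable; case: Omega_domain. Qed.

Local Notation vol := (vol mu Omega).
Local Notation norm := (hajlasz_norm mu A s p q Omega).

Let Q0 : 0 < Q. Proof. exact: lt_trans Q1. Qed.

Lemma cutoff_norm_vol : exists2 K : R, 0 < K &
  forall (x : X) (r : R), Omega x -> 0 < r <= 1 ->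
  exists N : R, [/\ hajlasz_space mu A s p q Omega (EFin \o cutoff x r),
    norm (EFin \o cutoff x r) = N%:E, 0 < N & N <= K * r `^ (- s) * vol x r `^ p^-1].
Proof.
have [K K0 HK] := hajlasz_norm_cutoff_le mu open_measurable A s p q s01 p0 q0.
exists K => // x r Ox /[dup] r1 /andP[rp _].
have [] := HK Omega x r measurable_Omega r1.
  by rewrite (volE mu)// ltry.
rewrite (volE mu)// => fA; rewrite poweR_EFin -EFinM => fN.
have r20 : 0 < r / 2 by rewrite divr_gt0.
have : (mu (ball x (r / 2) `&` Omega) `^ p^-1 <= norm (EFin \o cutoff x r))%E.
  apply: hajlasz_norm_ge => //; first exact: measurable_ball.
  by move=> z [zB _]; rewrite /= cutoff_eq1// normr1.
rewrite (volE mu)// poweR_EFin => Nf.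
have Nfin : norm (EFin \o cutoff x r) \is a fin_num.
  by rewrite fin_real// (lt_le_trans _ Nf) ?ltNyr//= (le_lt_trans fN) ?ltry.
exists (fine (norm (EFin \o cutoff x r))).
rewrite fineK//; split => //.
  rewrite fine_gt0// -ge0_fin_numE// ?Nfin ?andbT; last by apply: le_trans Nf; rewrite lee_fin powR_ge0.
  by apply: lt_le_trans Nf; rewrite lte_fin powR_gt0// (vol_gt0 mu).
by rewrite -lee_fin fineK.
Qed.

(** The cutoff equals 1 on the half ball, so its norm in the target space
    dominates a power of [vol x (r / 2)]. *)
Lemma embedding_halving : s * p < Q ->
  (exists C : R, forall f : X -> \bar R,
     hajlasz_space mu A s p q Omega f ->
     (LpnormS mu Omega (Q * p / (Q - s * p))%R f <= C%:E * norm f)%E) ->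
  exists2 C : R, 0 < C & forall (x : X) (r : R), Omega x -> 0 < r <= 1 ->
    vol x (r / 2) <= C * vol x r * (vol x r / r `^ Q) `^ (s * p / (Q - s * p)).
Proof.
move=> spQ [C HC]; have [K K0 HK] := cutoff_norm_vol.
have QD : 0 < Q - s * p by rewrite subr_gt0.
have /andP[s0 s1] := s01.
set P := Q * p / (Q - s * p) in HC *.
set beta := s * p / (Q - s * p).
have P0 : 0 < P by rewrite /P divr_gt0// mulr_gt0.
have CK0 : 0 < (`|C| + 1) * K by rewrite mulr_gt0// ltr_wpDl.
exists (((`|C| + 1) * K) `^ P); first exact: powR_gt0.
move=> x r Ox /[dup] r1 /andP[rp _].
have [N [fA NE N0 Nle]] := HK x r Ox r1.
have r20 : 0 < r / 2 by rewrite divr_gt0.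
have v0 : 0 < vol x r by exact: (vol_gt0 mu).
have v20 : 0 < vol x (r / 2) by exact: (vol_gt0 mu).
have h : vol x (r / 2) `^ P^-1 <= (`|C| + 1) * K * (r `^ (- s) * vol x r `^ p^-1).
  rewrite -lee_fin -poweR_EFin -(volE mu)//.
  apply: (@le_trans _ _ (LpnormS mu Omega P (EFin \o cutoff x r))).
    apply: LpnormS_ge => //; first exact: measurable_ball.
    by move=> z [zB _]; rewrite /= cutoff_eq1// normr1.
  apply: (le_trans (HC _ fA)); rewrite NE -EFinM lee_fin.
  apply: (@le_trans _ _ ((`|C| + 1) * N)).
    by apply: ler_wpM2r; [exact: ltW|rewrite (le_trans (ler_norm C))// lerDl].
  by rewrite -mulrA ler_wpM2l ?addr_ge0// mulrA.
have -> : vol x (r / 2) = (vol x (r / 2) `^ P^-1) `^ P.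
  by rewrite -powRrM mulVf ?gt_eqF// powRr1// ltW.
apply: (@le_trans _ _ (((`|C| + 1) * K * (r `^ (- s) * vol x r `^ p^-1)) `^ P)).
  apply: ge0_ler_powR; rewrite ?nnegrE ?powR_ge0 ?(ltW P0)//.
  by rewrite !mulr_ge0 ?powR_ge0 ?(ltW K0)// addr_ge0.
have rs0 : 0 <= r `^ (- s) * vol x r `^ p^-1 by rewrite mulr_ge0// powR_ge0.
rewrite (powRM P (ltW CK0) rs0) -[leRHS]mulrA.
apply: ler_wpM2l; first exact: powR_ge0.
rewrite (powRM P (powR_ge0 r (- s)) (powR_ge0 _ _)) -!powRrM.
have -> : vol x r / r `^ Q = vol x r * r `^ (- Q) by rewrite powRN.
rewrite (powRM beta (ltW v0) (powR_ge0 _ _)) -powRrM mulrA [leLHS]mulrC.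
have -> : - s * P = - Q * beta by rewrite /P /beta; ring.
apply: ler_wpM2r; first exact: powR_ge0.
have -> : p^-1 * P = 1 + beta.
  by rewrite /P /beta; field; rewrite !gt_eqF.
by rewrite powRD ?(gt_eqF v0) ?implybT// powRr1// ltW.
Qed.

Lemma measure_density_of_subcritical_embedding : s * p < Q ->
  (exists C : R, forall f : X -> \bar R,
     hajlasz_space mu A s p q Omega f ->
     (LpnormS mu Omega (Q * p / (Q - s * p))%R f <= C%:E * norm f)%E) ->
  measure_density mu Omega.
Proof.
move=> spQ /(embedding_halving spQ)[C C0 HC].
have [delta0 delta00 descent] := no_small_volume_descent mu Q Omega mu_metric
  mu_regular Omega_domain.
have QD : 0 < Q - s * p by rewrite subr_gt0.
have /andP[s0 s1] := s01.
have beta0 : 0 < s * p / (Q - s * p) by rewrite divr_gt0// mulr_gt0.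
set beta := s * p / (Q - s * p) in HC beta0.
(* With this threshold the factor that multiplies [vol x r] is at most the
   ratio of [(r / 2) `^ Q] to [r `^ Q]. *)
pose delta1 := (2 `^ (- Q) / C) `^ beta^-1.
have delta10 : 0 < delta1 by rewrite powR_gt0// divr_gt0// powR_gt0.
pose delta := Num.min (delta0 / 2) delta1.
have dpos : 0 < delta by rewrite lt_min delta10 divr_gt0.
have dlt : delta < delta0.
  by apply: (@le_lt_trans _ _ (delta0 / 2)); [rewrite ge_min lexx|lra].
apply: (measure_density_of_small_scales mu Q Omega mu_metric Q1 mu_regular
  Omega_domain delta r0) => //; first by rewrite r00.
move=> x r Ox /andP[rp rr0]; rewrite leNgt; apply/negP => small.
apply: (descent delta r x (fun t => vol x t <= delta * t `^ Q)) => //.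
- by apply: le_trans r0d; rewrite lee_fin.
- move=> t /andP[t0 tr] It; split => //.
  have v0 : 0 < vol x t by exact: (vol_gt0 mu).
  have tQ : 0 < t `^ Q by exact: powR_gt0.
  apply: le_trans (HC x t Ox _) _; first by rewrite t0/= (le_trans tr)// (le_trans rr0).
  have b : (vol x t / t `^ Q) `^ beta <= 2 `^ (- Q) / C.
    have -> : 2 `^ (- Q) / C = delta1 `^ beta.
      by rewrite /delta1 -powRrM mulVf ?gt_eqF// powRr1// divr_ge0 ?powR_ge0 ?ltW.
    apply: ge0_ler_powR; rewrite ?nnegrE ?(ltW beta0) ?(ltW delta10)//.
      by rewrite divr_ge0 ?(ltW v0) ?(ltW tQ).
    rewrite ler_pdivrMr//; apply: (le_trans It).
    by rewrite ler_pM2r// ge_min lexx orbT.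
  apply: (@le_trans _ _ (C * vol x t * (2 `^ (- Q) / C))).
    by apply: ler_wpM2l => //; rewrite mulr_ge0// ltW.
  have -> : C * vol x t * (2 `^ (- Q) / C) = 2 `^ (- Q) * vol x t.
    by field; rewrite gt_eqF.
  have -> : (t / 2) `^ Q = t `^ Q * 2 `^ (- Q).
    rewrite powRM ?(ltW t0)// powRN -[2^-1]powR_inv1// -!powRrM.
    by rewrite mulN1r powRN.
  by rewrite mulrA [leRHS]mulrC; apply: ler_wpM2l => //; exact: powR_ge0.
- exact: ltW.
Qed.

(** The exceptional null set cannot exhaust the traces on [Omega] of two balls,
    one around [x] on which the cutoff is 1 and one at distance comparable to
    [r] on which it is 0. *)
Lemma measure_density_of_hoelder_embedding : s * p > Q ->
  (exists C3 : R, forall f : X -> \bar R,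
     hajlasz_space mu A s p q Omega f ->
     exists E : set X, [/\ measurable E, mu E = 0%E &
       forall x y : X, (Omega `\` E) x -> (Omega `\` E) y ->
       (`|f x - f y| <= C3%:E * norm f * ((mdist x y) `^ (s - Q / p))%R%:E)%E]) ->
  measure_density mu Omega.
Proof.
move=> spQ [C HC]; have [K K0 HK] := cutoff_norm_vol.
have g0 : 0 <= s - Q / p by rewrite subr_ge0 ler_pdivrMr// ltW.
set g := s - Q / p in g0 HC.
have C0 : 0 < `|C| + 1 by rewrite ltr_wpDl.
pose C4 := (`|C| + 1) * K * 4 `^ g.
have C40 : 0 < C4 by rewrite !mulr_gt0// powR_gt0.
have r20 : 0 < r0 / 2 by rewrite divr_gt0.
have r2r0 : r0 / 2 <= r0 by rewrite ler_pdivrMr// ler_peMr ?(ltW r00)// ler1n.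
apply: (measure_density_of_small_scales mu Q Omega mu_metric Q1 mu_regular
  Omega_domain (C4 `^ (- p)) (r0 / 2)).
- exact: powR_gt0.
- by rewrite r20 (le_trans r2r0).
- by apply: le_trans r0d; rewrite lee_fin.
move=> x r Ox /andP[rp rr0].
have rle1 : 0 < r <= 1 by rewrite rp (le_trans rr0)// (le_trans r2r0).
have [N [fA NE N0 Nle]] := HK x r Ox rle1.
have [E [mE E0 HE]] := HC _ fA.
have [y Oy xy] : exists2 y, Omega y & mdist x y = 2 * r.
  apply: spheres => //; rewrite mulr_gt0//=.
  by move: rr0; rewrite ler_pdivlMr// mulrC.
have [x' [Bx' Ox'] Ex'] : exists2 x', (ball x (r / 2) `&` Omega) x' & ~ E x'.
  apply: (positive_measure_minus_null mu) => //.
    exact: (measurable_ball_domain mu).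
  have rr : 0 < r / 2 by rewrite divr_gt0.
  by rewrite (volE mu)// lte_fin (vol_gt0 mu).
have [y' [By' Oy'] Ey'] : exists2 y', (ball y r `&` Omega) y' & ~ E y'.
  apply: (positive_measure_minus_null mu) => //.
    exact: (measurable_ball_domain mu).
  by rewrite (volE mu)// lte_fin (vol_gt0 mu).
have v0 : 0 < vol x r by exact: (vol_gt0 mu).
have := HE x' y' (conj Ox' Ex') (conj Oy' Ey').
have fx' : cutoff x r x' = 1 by exact: cutoff_eq1.
move: Bx' By'; rewrite !ballEmdist/= => Bx' By'.
have fy' : cutoff x r y' = 0.
  apply: cutoff_eq0 => //; rewrite ballEmdist/=; apply/negP; rewrite -leNgt.
  have := metric_triangle x y' y; rewrite (metric_sym y' y); lra.
have dxy : mdist x' y' <= 4 * r.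
  have := metric_triangle x' x y'; have := metric_triangle x y y'.
  rewrite (metric_sym x' x); lra.
rewrite /= fx' fy' NE /= subr0 normr1 -?EFinM lee_fin => h.
have {}h : 1 <= C4 * (vol x r `^ p^-1 * r `^ (- (Q / p))).
  apply: (le_trans h).
  apply: (@le_trans _ _ ((`|C| + 1) * (K * r `^ (- s) * vol x r `^ p^-1) * (4 * r) `^ g)).
    apply: (@le_trans _ _ ((`|C| + 1) * N * mdist x' y' `^ g)).
      apply: ler_wpM2r; first exact: powR_ge0.
      by apply: ler_wpM2r; [exact: ltW|rewrite (le_trans (ler_norm C))// lerDl].
    apply: ler_pM; rewrite ?powR_ge0 ?mulr_ge0 ?(ltW C0) ?(ltW N0)//.
      by apply: ler_wpM2l => //; exact: ltW.
    by apply: ge0_ler_powR; rewrite ?nnegrE ?mdist_ge0 ?mulr_ge0 ?(ltW rp).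
  rewrite powRM ?(ltW rp)// /C4.
  have -> : - (Q / p) = - s + g by rewrite /g; ring.
  have -> : r `^ (- s + g) = r `^ (- s) * r `^ g.
    by rewrite powRD// (gt_eqF rp) implybT.
  by rewrite le_eqVlt; apply/orP; left; apply/eqP; ring.
have {}h : r `^ (Q / p) <= C4 * vol x r `^ p^-1.
  by move: h; rewrite powRN mulrA ler_pdivlMr ?powR_gt0// mul1r.
have rE : r `^ Q = (r `^ (Q / p)) `^ p by rewrite -powRrM divfK// gt_eqF.
have vE : vol x r = (vol x r `^ p^-1) `^ p.
  by rewrite -powRrM mulVf ?gt_eqF// powRr1// ltW.
rewrite powRN mulrC ler_pdivrMr ?powR_gt0// rE vE.
rewrite -powRM ?(ltW C40) ?powR_ge0// [_ * C4]mulrC.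
apply: ge0_ler_powR; rewrite ?nnegrE ?powR_ge0 ?(ltW p0)//.
by rewrite mulr_ge0 ?powR_ge0 ?(ltW C40).
Qed.

Lemma vol_add_le (x y z : X) (r t : R) : 0 < r -> 0 < t ->
  2 * r <= mdist x y -> ball x r `<=` ball z t -> ball y r `<=` ball z t ->
  vol x r + vol y r <= vol z t.
Proof.
move=> rp tp xy xz yz; rewrite -lee_fin EFinD -!(volE mu)//.
have mB w u : measurable (ball w u `&` Omega : set X).
  exact: (measurable_ball_domain mu).
rewrite -measureU//; last first.
  apply/seteqP; split => // w [[+ _] [+ _]]; rewrite !ballEmdist/=.
  have := metric_triangle x w y; rewrite (metric_sym w y); lra.
apply: le_measure; rewrite ?inE//; first exact: measurableU.
by move=> w [[/xz ? ?]|[/yz ? ?]].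
Qed.

(** Whatever the constant [a] is, the cutoff differs from it by at least [1 / 2]
    on the inner ball or on the outer annulus. *)
Lemma cutoff_away_from_cst (a : \bar R) (b N : R) (x : X) (r : R) :
  0 < b -> 0 < N -> 0 < r ->
  ((expR (b / (2 * N)))%:E * mu (ball x (r / 2) `&` Omega) <=
    \int[mu]_(z in ball x (2 * r) `&` Omega)
      expeR (b%:E * (`|(cutoff x r z)%:E - a| / N%:E)))%E \/
  ((expR (b / (2 * N)))%:E *
      mu ((ball x (2 * r) `&` Omega) `\` (ball x r `&` Omega)) <=
    \int[mu]_(z in ball x (2 * r) `&` Omega)
      expeR (b%:E * (`|(cutoff x r z)%:E - a| / N%:E)))%E.
Proof.
move=> b0 N0 rp.
have mB w u : measurable (ball w u `&` Omega : set X).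
  exact: (measurable_ball_domain mu).
have big (u : R) : ((2^-1)%:E <= `|u%:E - a|)%E ->
    ((expR (b / (2 * N)))%:E <= expeR (b%:E * (`|u%:E - a| / N%:E)))%E.
  move=> ua; rewrite -[leLHS]/(expeR (b / (2 * N))%:E) lee_expeR.
  have -> : b / (2 * N) = b * (2^-1 / N) by rewrite invfM.
  rewrite EFinM; apply: lee_wpmul2l; first by rewrite lee_fin ltW.
  rewrite inver gt_eqF// EFinM; apply: lee_wpmul2r => //.
  by rewrite lee_fin invr_ge0 ltW.
have away : ((2^-1)%:E <= `|1%:E - a|)%E \/ ((2^-1)%:E <= `|0%:E - a|)%E.
  case: a {big} => [a| |]; last 2 first.
  - by left; rewrite leey.
  - by left; rewrite leey.
  rewrite -!EFinB !abse_EFin !lee_fin.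
  have [h|h] := leP (2^-1) `|1 - a|; [by left|right].
  by move: h; rewrite ltr_norml => /andP[h1 h2]; rewrite ler_normr; lra.
case: away => away; [left|right]; apply: integral_ge_cst => //; rewrite ?expR_ge0//.
- by apply: setSI; apply: le_ball; lra.
- by move=> z _; exact: expeR_ge0.
- by move=> z [zB _]; rewrite cutoff_eq1//; exact: big.
- by apply: measurableD; exact: mB.
- by move=> z _; exact: expeR_ge0.
- move=> z [[zB Oz] nz]; rewrite cutoff_eq0//; first exact: big.
  by move=> zr; apply: nz.
Qed.

(** When [s * p = Q], the norm of the cutoff is at most a multiple of
    [al `^ p^-1], where [al] is the fraction [vol x r / r `^ Q].  The exponential
    of a multiple of the inverse of the norm is therefore at least a multiple of
    [al ^- 2].  One factor [1 / al] turns [r `^ Q] into [vol x r]; the other one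
    beats all constants when [al] is small. *)
Lemma moser_trudinger_dichotomy (eps : R) : 0 < eps -> s * p = Q ->
  (exists C1 C2 : R, [/\ 0 < C1, 0 < C2 &
     forall f : X -> \bar R, hajlasz_space mu A s p q Omega f ->
     norm f != 0%E ->
     forall (z : X) (r : R), 0 < r ->
     (0 < mu (ball z r `&` Omega))%E ->
     (\int[mu]_(x in ball z r `&` Omega)
        expeR (C1%:E * (`|f x - mean mu (ball z r `&` Omega) f| / norm f))
      <= C2%:E * mu (ball z r))%E]) ->
  exists2 delta : R, 0 < delta & forall x r, Omega x -> 0 < r -> 2 * r <= r0 ->
    vol x r <= delta * r `^ Q ->
    vol x (r / 2) <= eps * vol x r \/ vol x (2 * r) <= (1 + eps) * vol x r.
Proof.
move=> eps0 spQ [C1 [C2 [C10 C20 HC]]]; have [K K0 HK] := cutoff_norm_vol.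
case: mu_regular => c c1 reg.
have c0 : 0 < c by lra.
pose D := C2 * (c * 2 `^ Q).
have D0 : 0 < D by rewrite !mulr_gt0// powR_gt0.
pose k := C1 / (2 * K) / (2 * p).
have k0 : 0 < k by rewrite !divr_gt0// mulr_gt0.
exists (k `^ (2 * p) * eps / D).
  by rewrite divr_gt0// mulr_gt0// powR_gt0.
move=> x r Ox rp rr0 small.
have r2p : 0 < 2 * r by rewrite mulr_gt0.
have rle1 : 0 < r <= 1 by rewrite rp/=; apply: le_trans r01; lra.
have [N [fA NE N0 Nle]] := HK x r Ox rle1.
have v0 : 0 < vol x r by exact: (vol_gt0 mu).
have rQ : 0 < r `^ Q by exact: powR_gt0.
pose al := vol x r / r `^ Q.
have al0 : 0 < al by rewrite divr_gt0.
have Nal : N <= K * al `^ p^-1.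
  apply: (le_trans Nle); rewrite -mulrA; apply: ler_wpM2l; first exact: ltW.
  have -> : - s = - (Q / p) by rewrite -spQ mulfK// gt_eqF.
  by rewrite /al -powRN powRM ?(ltW v0) ?powR_ge0// -powRrM mulNr mulrC.
have expN : k `^ (2 * p) * (al ^+ 2)^-1 <= expR (C1 / (2 * N)).
  have y0 : 0 <= C1 / (2 * N) by rewrite divr_ge0 ?mulr_ge0 ?ltW.
  apply: le_trans (powR_le_expR _ (2 * p) _ y0); last by rewrite mulr_gt0.
  have -> : (al ^+ 2)^-1 = (al `^ p^-1)^-1 `^ (2 * p).
    rewrite -[in RHS]powRN -powRrM.
    have -> : - p^-1 * (2 * p) = - 2 by field; rewrite gt_eqF.
    by rewrite powRN powR_mulrn// ltW.
  rewrite -powRM ?(ltW k0) ?invr_ge0 ?powR_ge0//.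
  have alp : 0 < al `^ p^-1 by exact: powR_gt0.
  have p20 : 0 < 2 * p by rewrite mulr_gt0.
  have kle : k * (al `^ p^-1)^-1 <= C1 / (2 * N) / (2 * p).
    rewrite /k mulrAC; apply: ler_wpM2r; first by rewrite invr_ge0 ltW.
    rewrite -mulrA -invfM -mulrA; apply: ler_wpM2l; first exact: ltW.
    by rewrite lef_pV2 ?posrE ?mulr_gt0// ler_pM2l.
  have k0' : 0 <= k * (al `^ p^-1)^-1 by rewrite divr_ge0 ?ltW.
  apply: ge0_ler_powR; rewrite ?nnegrE//; first exact: ltW.
  exact: le_trans kle.
have Ebig : D * r `^ Q <= eps * vol x r * expR (C1 / (2 * N)).
  apply: (@le_trans _ _ (eps * vol x r * (k `^ (2 * p) * (al ^+ 2)^-1))); last first.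
    by apply: ler_wpM2l => //; rewrite mulr_ge0// ltW.
  have vE : vol x r = al * r `^ Q by rewrite divfK// gt_eqF.
  have alle : al <= k `^ (2 * p) * eps / D by rewrite ler_pdivrMr.
  have -> : eps * vol x r * (k `^ (2 * p) * (al ^+ 2)^-1) =
     (k `^ (2 * p) * eps) / al * r `^ Q.
    by rewrite vE; field; rewrite gt_eqF.
  rewrite ler_pM2r// ler_pdivlMr// mulrC -ler_pdivlMr//.
have cst S : measurable S -> (mu S <= (vol x (2 * r))%:E)%E ->
   ((expR (C1 / (2 * N)))%:E * mu S <= C2%:E * mu (ball x (2 * r)))%E ->
   (mu S <= (eps * vol x r)%:E)%E.
  move=> mS Sv SC.
  have Sfin : mu S \is a fin_num.
    by rewrite ge0_fin_numE//; apply: le_lt_trans Sv _; exact: ltry.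
  move: SC; rewrite -(fineK Sfin) lee_fin => SC.
  have rd : ((2 * r)%:E <= @diam _ _ X)%E by apply: le_trans r0d; rewrite lee_fin.
  have /andP[_ up] := reg x _ r2p rd.
  have : ((expR (C1 / (2 * N)))%:E * (fine (mu S))%:E <= C2%:E * (c * (2 * r) `^ Q)%:E)%E.
    by apply: (le_trans SC); apply: lee_wpmul2l => //; rewrite lee_fin ltW.
  rewrite -!EFinM lee_fin powRM ?(ltW rp)// => h.
  rewrite -(ler_pM2l (expR_gt0 (C1 / (2 * N)))) (le_trans h)// [leRHS]mulrC.
  by apply: le_trans Ebig; rewrite /D !mulrA.
have f0 : norm (EFin \o cutoff x r) != 0%E by rewrite NE eqe gt_eqF.
have v20 : (0 < mu (ball x (2 * r) `&` Omega))%E.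
  by rewrite (volE mu)// lte_fin (vol_gt0 mu).
have := HC _ fA f0 x (2 * r) r2p v20; rewrite NE => MT.
have mB w u : measurable (ball w u `&` Omega : set X).
  exact: (measurable_ball_domain mu).
have [h|h] := cutoff_away_from_cst
    (mean mu (ball x (2 * r) `&` Omega) (EFin \o cutoff x r)) C1 N x r C10 N0 rp;
  [left|right].
- have rr : 0 < r / 2 by rewrite divr_gt0.
  rewrite -lee_fin -(volE mu)//; apply: cst => //.
    rewrite (volE mu)// lee_fin; apply: (le_vol mu) => //.
    by apply: le_ball; lra.
  exact: le_trans h MT.
- have sub : ball x r `&` Omega `<=` ball x (2 * r) `&` Omega.
    by apply: setSI; apply: le_ball; lra.
  have volD : ((vol x (2 * r))%:E = mu ((ball x (2 * r) `&` Omega) `\`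
      (ball x r `&` Omega)) + (vol x r)%:E)%E.
    rewrite -!(volE mu)//.
    by have := measureDI mu (mB x (2 * r)) (mB x r); rewrite (setIidr sub).
  have -> : (1 + eps) * vol x r = eps * vol x r + vol x r by ring.
  rewrite -lee_fin volD EFinD.
  apply: leeD => //; apply: cst.
  + by apply: measurableD; exact: mB.
  + by rewrite volD leeDl// lee_fin ltW.
  + exact: le_trans h MT.
Qed.

(** Below the threshold the first alternative of the dichotomy would propagate
    to all smaller radii, so the volume at most grows by the factor [1 + eps]
    when the radius doubles.  For [1 + eps <= 5 / 4] this contradicts the
    presence of two disjoint balls of radius [r] each of which lies in the ball
    of radius [4 * r] around the centre of the other. *)
Lemma measure_density_of_moser_trudinger : s * p = Q ->
  (exists C1 C2 : R, [/\ 0 < C1, 0 < C2 &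
     forall f : X -> \bar R, hajlasz_space mu A s p q Omega f ->
     norm f != 0%E ->
     forall (z : X) (r : R), 0 < r ->
     (0 < mu (ball z r `&` Omega))%E ->
     (\int[mu]_(x in ball z r `&` Omega)
        expeR (C1%:E * (`|f x - mean mu (ball z r `&` Omega) f| / norm f))
      <= C2%:E * mu (ball z r))%E]) ->
  measure_density mu Omega.
Proof.
move=> spQ MT.
(* [eps <= 2 `^ (- Q)] lets the smallness of the volume fraction pass to half
   the radius, and [eps <= 1 / 4] serves the comparison of the balls. *)
pose eps : R := 2 `^ (- Q) / 4.
have two0 : 0 < 2 `^ (- Q) :> R by exact: powR_gt0.
have two1 : 2 * 2 `^ (- Q) <= 1 :> R.
  rewrite -{1}[2]powRr1// -powRD ?pnatr_eq0 ?implybT// -[leRHS](powRr0 2).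
  by apply: ler_powR; rewrite ?ler1n// subr_le0 ltW.
have eps0 : 0 < eps by rewrite /eps; lra.
have eps4 : eps <= 1 / 4 by rewrite /eps; lra.
have eps2 : (1 + eps) * eps < 1 by nra.
have [delta1 delta10 dich] := moser_trudinger_dichotomy eps eps0 spQ MT.
have [delta0 delta00 descent] := no_small_volume_descent mu Q Omega mu_metric
  mu_regular Omega_domain.
pose delta := Num.min (delta0 / 2) delta1.
have dpos : 0 < delta by rewrite lt_min delta10 divr_gt0.
have dlt : delta < delta0.
  by apply: (@le_lt_trans _ _ (delta0 / 2)); [rewrite ge_min lexx|lra].
have vpos x (r : R) : Omega x -> 0 < r -> 0 < vol x r by exact: (vol_gt0 mu).
have dich' x (r : R) : Omega x -> 0 < r -> 2 * r <= r0 -> vol x r <= delta * r `^ Q ->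
    vol x (r / 2) <= eps * vol x r \/ vol x (2 * r) <= (1 + eps) * vol x r.
  move=> Ox rp rr small; apply: dich => //; apply: (le_trans small).
  by rewrite ler_pM2r ?powR_gt0// ge_min lexx orbT.
have half (t : R) : 0 < t -> (t / 2) `^ Q = 2 `^ (- Q) * t `^ Q.
  by move=> t0; rewrite powRM ?(ltW t0)// mulrC -powR_inv1// -powRrM mulN1r.
have grow x (r : R) : Omega x -> 0 < r -> 2 * r <= r0 -> vol x r <= delta * r `^ Q ->
    vol x (2 * r) <= (1 + eps) * vol x r.
  move=> Ox rp rr small; have [h|//] := dich' x r Ox rp rr small.
  exfalso; apply: (descent delta r x
    (fun t => vol x t <= delta * t `^ Q /\ vol x (t / 2) <= eps * vol x t)) => //.
    by apply: le_trans r0d; rewrite lee_fin; lra.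
  move=> t /andP[t0 tr] [It1 It2]; have vt := vpos x t Ox t0.
  have t20 : 0 < t / 2 by rewrite divr_gt0.
  have small2 : vol x (t / 2) <= delta * (t / 2) `^ Q.
    apply: (le_trans It2); rewrite half// mulrCA.
    by apply: ler_pM => //; [exact: ltW|exact: ltW|rewrite /eps; lra].
  split => //; split => //.
  have rr2 : 2 * (t / 2) <= r0 by lra.
  have [//|] := dich' x (t / 2) Ox t20 rr2 small2.
  rewrite mulrC divfK// => h2.
  have : vol x t <= (1 + eps) * (eps * vol x t).
    by apply: (le_trans h2); apply: ler_wpM2l => //; lra.
  by rewrite leNgt mulrA gtr_pMl// eps2.
apply: (measure_density_of_small_scales mu Q Omega mu_metric Q1 mu_regular
  Omega_domain delta (r0 / 4)) => //.
- by rewrite divr_gt0//= ler_pdivrMr// mul1r (le_trans r01)// ler1n.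
- by apply: le_trans r0d; rewrite lee_fin ler_pdivrMr// ler_peMr ?(ltW r00)// ler1n.
move=> x r Ox /andP[rp rr0]; rewrite leNgt; apply/negP => /ltW small.
have rr4 : 4 * r <= r0 by move: rr0; rewrite ler_pdivlMr// mulrC.
have r2p : 0 < 2 * r by lra.
have rQ : 0 < delta * r `^ Q by rewrite mulr_gt0// powR_gt0.
(* The threshold grows by the factor [2 `^ Q >= 2] from [r] to [2 * r], more
   than the volume, so the growth bound applies twice. *)
have quad z : Omega z -> vol z r <= delta * r `^ Q ->
    vol z (4 * r) <= 25 / 16 * vol z r.
  move=> Oz smallz; have vz := vpos z r Oz rp.
  have g1 : vol z (2 * r) <= (1 + eps) * vol z r by apply: grow => //; lra.
  have dd : 2 * (delta * r `^ Q) <= delta * (2 * r) `^ Q.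
    have rE : r `^ Q = 2 `^ (- Q) * (2 * r) `^ Q.
      by rewrite -half//; congr (_ `^ _); lra.
    rewrite {1}rE; have : 0 <= delta * (2 * r) `^ Q by rewrite mulr_ge0 ?powR_ge0// ltW.
    nra.
  have g2 : vol z (2 * (2 * r)) <= (1 + eps) * vol z (2 * r).
    apply: grow => //; first lra.
    by apply: le_trans dd; nra.
  have -> : 4 * r = 2 * (2 * r) by ring.
  have v2 := vpos z _ Oz r2p.
  nra.
have [y Oy xy] : exists2 y, Omega y & mdist x y = 2 * r.
  by apply: spheres => //; rewrite r2p; lra.
have vx := vpos x r Ox rp; have vy := vpos y r Oy rp.
have xquad := quad x Ox small.
have disj : vol x r + vol y r <= vol x (4 * r).
  apply: vol_add_le => //; first lra.
  - by rewrite xy.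
  - by apply: le_ball; lra.
  - by apply: subset_ball; rewrite xy; lra.
have smally : vol y r <= delta * r `^ Q by lra.
have yquad := quad y Oy smally.
have back : vol x r <= vol y (4 * r).
  apply: (le_vol mu) => //; first lra.
  by apply: subset_ball; rewrite metric_sym xy; lra.
lra.
Qed.

End necessity.

Theorem theorem5p1 (d : measure_display) (R : realType)
    (X : metricMeasurableType d R) (mu : {measure set X -> \bar R})
    (Q : R) (Omega : set X) (s p : R) (q : \bar R) (A : hajlasz_scale) :
  metric_measure_space mu -> 1 < Q -> regular_measure Q mu -> geodesic X ->
  domain Omega ->
  0 < s < 1 -> 0 < p -> (0 < q)%E ->
  [/\ s * p < Q ->
      (exists C : R, forall f : X -> \bar R,
         hajlasz_space mu A s p q Omega f ->
         (LpnormS mu Omega (Q * p / (Q - s * p))%R f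
            <= C%:E * hajlasz_norm mu A s p q Omega f)%E) ->
      measure_density mu Omega,

      s * p = Q ->
      (exists C1 C2 : R, [/\ 0 < C1, 0 < C2 &
         forall f : X -> \bar R, hajlasz_space mu A s p q Omega f ->
         hajlasz_norm mu A s p q Omega f != 0%E ->
         forall (z : X) (r : R), 0 < r ->
         (0 < mu (ball z r `&` Omega))%E ->
         (\int[mu]_(x in ball z r `&` Omega)
            expeR (C1%:E * (`|f x - mean mu (ball z r `&` Omega) f|
                            / hajlasz_norm mu A s p q Omega f))
          <= C2%:E * mu (ball z r))%E]) ->
      measure_density mu Omega &

      s * p > Q ->
      (exists C3 : R, forall f : X -> \bar R,
         hajlasz_space mu A s p q Omega f ->
         exists E : set X, [/\ measurable E, mu E = 0%E &
           forall x y : X, (Omega `\` E) x -> (Omega `\` E) y ->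
           (`|f x - f y| <= C3%:E * hajlasz_norm mu A s p q Omega f
                            * ((mdist x y) `^ (s - Q / p))%R%:E)%E]) ->
      measure_density mu Omega].
Proof.
move=> mms Q1 reg _ dom s01 p0 q0.
(* A one-point space is its own only domain. *)
have [two|one] := pselect (exists a b : X, a <> b).
  have [r0 [r00 r01 r0d spheres]] := domain_meets_spheres mu Q Omega mms Q1 reg dom two.
  split => spQ H.
  - exact: (measure_density_of_subcritical_embedding mu Q Omega mms Q1 reg dom
      A s p q s01 p0 q0 r0 r00 r01 r0d spQ H).
  - exact: (measure_density_of_moser_trudinger mu Q Omega mms Q1 reg dom
      A s p q s01 p0 q0 r0 r00 r01 r0d spheres spQ H).
  - exact: (measure_density_of_hoelder_embedding mu Q Omega mms Q1 reg dom
      A s p q s01 p0 q0 r0 r00 r01 r0d spheres spQ H).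
have OT : Omega = setT.
  have [[a Oa] _ _] := dom; apply/seteqP; split => // z _.
  suff -> : z = a by [].
  by apply: contrapT => za; apply: one; exists z, a.
have MD : measure_density mu Omega.
  by exists 1 => // x r _ _; rewrite mul1e OT setIT.
by split.
Qed.
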